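(* Let $G$ be a graph on $n\ge 2$ vertices whose diameter is $5$ or more, and let $k=|D(G)|/2$. Then $$\lambda_2(G)\ \ge\ \frac{n-k+1-\sqrt{(n-k+1)^2-4(n-2k)}}{2}.$$
   Context: Graphs are finite, simple and undirected. The Laplacian of a graph on $n$ vertices is $L=\Delta-A$, where $\Delta$ is the diagonal matrix of degrees and $A$ is the adjacency matrix; its eigenvalues are listed as $0=\lambda_1(G)\le\lambda_2(G)\le\cdots\le\lambda_n(G)$ with multiplicity. $d(x,v)$ denotes graph distance (equal to $\infty$ if $x,v$ lie in different components), the diameter is the maximum distance between two vertices, and $D(G)=\{v\in V(G): \text{there is some } x\in V(G)\text{ with } d(x,v)\ge 3\}$. *)

(* Defs.v *)
From mathcomp Require Import all_boot all_order all_algebra.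
From mathcomp Require Import polyrcf complex spectral constructive_ereal.

Set Implicit Arguments.
Unset Strict Implicit.
Unset Printing Implicit Defensive.

Import Order.TTheory GRing.Theory Num.Theory.
Local Open Scope ring_scope.

Record sgraph := SGraph {
  vertex :> finType;
  adj : rel vertex;
  adj_sym : symmetric adj;
  adj_irrefl : irreflexive adj
}.

Section Distance.
Variable G : sgraph.
Implicit Types x y v : G.

Definition walk (d : nat) x y : bool :=
  [exists p : d.-tuple G, path (@adj G) x p && (last x p == y)].

Lemma connect_walk x y : connect (@adj G) x y -> exists d, walk d x y.
Proof.
case/connectP=> p xp ->; exists (size p).
by apply/existsP; exists (in_tuple p); rewrite xp eqxx.
Qed.

Definition dist x y : \bar int :=
  if @idP (connect (@adj G) x y) is ReflectT cxy
  then (ex_minn (connect_walk cxy))%:Z%:E else +oo%E.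

(* Infinite as soon as [G] is disconnected. *)
Definition diameter : \bar int :=
  \big[maxe/0%E]_(x : G) \big[maxe/0%E]_(y : G) dist x y.

(* The set written D(G). *)
Definition far_set : {set G} := [set v | [exists x, (3%:Z%:E <= dist x v)%E]].

End Distance.

Section Laplacian.
Variables (R : rcfType) (G : sgraph).

Definition degree (v : G) : nat := #|[set u | adj v u]|.

(* Vertices are numbered by [enum_val]; the spectrum does not depend on it. *)
Definition degree_mx : 'M[R]_#|G| :=
  diag_mx (\row_i (degree (enum_val i))%:R).

Definition adjacency_mx : 'M[R]_#|G| :=
  \matrix_(i, j) (adj (enum_val i) (enum_val j))%:R.

Definition laplacian : 'M[R]_#|G| := degree_mx - adjacency_mx.

End Laplacian.

(* [rootsR p] is the increasing list of the distinct roots of [p] in [R]. *)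
Definition eigenvalues (R : rcfType) n (A : 'M[R]_n) : seq R :=
  flatten [seq nseq (mup a (char_poly A)) a | a <- rootsR (char_poly A)].

Lemma char_poly_conj (F : fieldType) n (P A D : 'M[F]_n) :
  P \in unitmx -> A = invmx P *m D *m P -> char_poly A = char_poly D.
Proof.
move=> uP ->; rewrite /char_poly.
pose Q := map_mx polyC P; pose Qi := map_mx polyC (invmx P).
have QiQ : Qi *m Q = 1%:M by rewrite -map_mxM /= mulVmx // map_mx1.
have -> : char_poly_mx (invmx P *m D *m P) = Qi *m char_poly_mx D *m Q.
  rewrite /char_poly_mx !map_mxM /= -/Q -/Qi mulmxBr mulmxBl; congr (_ - _).
  by rewrite scalar_mxC -mulmxA QiQ mulmx1.
by rewrite !det_mulmx mulrAC -det_mulmx QiQ det1 mul1r.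
Qed.

Lemma char_poly_split (R : rcfType) n (A : 'M[R]_n) : A^T = A ->
  exists s : seq R, char_poly A = \prod_(a <- s) ('X - a%:P).
Proof.
move=> symA; pose B := map_mx (real_complex R) A.
have hB : B \is hermsymmx.
  apply: realsym_hermsym.
    apply/is_hermitianmxP; rewrite expr0 scale1r map_mx_id //.
    by rewrite /B map_trmx symA.
  by apply/mxOverP=> i j; rewrite mxE; apply/complex_realP; exists (A i j).
have/mxOverP Dr := hermitian_spectral_diag_real hB.
have /hermitian_normalmx /orthomx_spectralP eB := hB.
have : map_poly (real_complex R) (char_poly A) = char_poly B.
  exact: map_char_poly.
rewrite (char_poly_conj (spectral_unit B) eB).
rewrite (char_poly_trig (diag_mx_is_trig _)) => eBA.
exists [seq complex.Re (spectral_diag B 0 i) | i <- enum 'I_n].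
apply: (map_poly_inj (real_complex R)); rewrite eBA rmorph_prod big_map big_enum.
apply: eq_bigr => i _; rewrite rmorphB /= map_polyX map_polyC /=.
by rewrite RRe_real ?Dr // !mxE eqxx.
Qed.

Lemma eigenvalues_sorted (R : rcfType) n (A : 'M[R]_n) :
  sorted <=%R (eigenvalues A).
Proof.
rewrite /eigenvalues; have : sorted <%R (rootsR (char_poly A)).
  exact: sorted_roots.
rewrite lt_sorted_pairwise le_sorted_pairwise.
elim: (rootsR _) => //= a s IH /andP[/allP al /IH ps].
rewrite pairwise_cat ps andbT; apply/andP; split.
  apply/allrelP=> x y /nseqP[-> _] /flatten_mapP[b bs /nseqP[-> _]].
  exact/ltW/al.
by elim: (mup _ _) => //= m ->; rewrite all_nseq lexx orbT.
Qed.

(* For symmetric matrices no eigenvalue is missed: the roots of the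
   characteristic polynomial are all in [R]. *)
Lemma eigenvaluesP (R : rcfType) n (A : 'M[R]_n) : A^T = A ->
  char_poly A = \prod_(a <- eigenvalues A) ('X - a%:P).
Proof.
move=> /char_poly_split[s es].
have p0 : char_poly A != 0 by rewrite monic_neq0 ?char_poly_monic.
rewrite [LHS]es; apply: perm_big; apply/allP=> x _ /=; apply/eqP.
rewrite -[LHS]mu_prod_XsubC -es /eigenvalues.
have := roots_on_rootsR p0 x; rewrite inE /= => rx.
have : uniq (rootsR (char_poly A)) by exact: uniq_roots.
rewrite count_flatten -map_comp.
have -> : mup x (char_poly A)
    = if x \in rootsR (char_poly A) then mup x (char_poly A) else 0%N.
  by case: ifP => // /negbT; rewrite -rx => /mupNroot.
elim: (rootsR _) => //= a t IH /andP[at' /IH <-].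
rewrite count_nseq /= in_cons; case: (eqVneq a x) => [<-|].
  by rewrite (negbTE at') mul1n addn0.
by rewrite mul0n add0n.
Qed.

Lemma laplacian_sym (R : rcfType) (G : sgraph) :
  (laplacian R G)^T = laplacian R G.
Proof.
rewrite /laplacian linearB /= tr_diag_mx; congr (_ - _).
by apply/matrixP=> i j; rewrite !mxE adj_sym.
Qed.

Lemma laplacian_eigenvaluesP (R : rcfType) (G : sgraph) :
  char_poly (laplacian R G)
    = \prod_(a <- eigenvalues (laplacian R G)) ('X - a%:P).
Proof. exact/eigenvaluesP/laplacian_sym. Qed.

(* Numbered from 1, as in lambda_1 <= ... <= lambda_n. *)
Definition lambda (R : rcfType) (G : sgraph) (i : nat) : R :=
  (eigenvalues (laplacian R G))`_i.-1.

Arguments diameter G : clear implicits.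
Arguments far_set G : clear implicits.

(* Main.v *)
Require Import Defs.
From mathcomp Require Import all_boot all_order all_algebra.
From mathcomp Require Import constructive_ereal.
From mathcomp Require Import zify ring lra.

Set Implicit Arguments.
Unset Strict Implicit.
Unset Printing Implicit Defensive.

Import Order.TTheory GRing.Theory Num.Theory.
Local Open Scope ring_scope.

(** A vertex outside D(G) is within distance 2 of every vertex, so its existence
    forces the diameter to be at most 4.  Hence diameter at least 5 gives
    D(G) = V(G) and n = 2k; the right-hand side is then 0, and the bound says
    no more than that the Laplacian is positive semidefinite. *)

Lemma walkP (G : sgraph) (d : nat) (x y : G) :
  reflect (exists2 p : seq G, path (@adj G) x p & size p = d /\ last x p = y)
          (walk d x y).
Proof.
apply: (iffP existsP) => [[p /andP[xp /eqP lp]]|[p xp [sp lp]]].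
  by exists p; rewrite ?size_tuple.
have sp' : size p == d by apply/eqP.
by exists (Tuple sp'); rewrite /= xp lp eqxx.
Qed.

Lemma walk_sym (G : sgraph) (d : nat) (x y : G) : walk d x y -> walk d y x.
Proof.
(* [p] omits the starting vertex [x]; [belast x p] puts it back and drops the end [y], which becomes
   the new starting vertex. *)
case/walkP=> p xp [sp lp]; apply/walkP; exists (rev (belast x p)); last first.
  rewrite size_rev size_belast; split=> //.
  by case: p {xp sp} lp => [|z p] //= _; rewrite rev_cons last_rcons.
rewrite -lp rev_path (eq_path (e' := @adj G)) // => u v.
exact: adj_sym.
Qed.

Lemma walk_cat (G : sgraph) (d e : nat) (x y z : G) :
  walk d x y -> walk e y z -> walk (d + e) x z.
Proof.
case/walkP=> p xp [<- lp] /walkP[q yq [<- lq]]; apply/walkP; exists (p ++ q).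
  by rewrite cat_path xp lp.
by rewrite size_cat last_cat lp.
Qed.

Lemma dist_le_walk (G : sgraph) (d : nat) (x y : G) :
  walk d x y -> (dist x y <= d%:Z%:E)%E.
Proof.
move=> w; rewrite /dist; case: {-}_ / idP => [cxy|[]].
  by case: ex_minnP => m _ /(_ d w) md; rewrite lee_fin lez_nat.
by case/walkP: w => p xp [_ <-]; apply/connectP; exists p.
Qed.

(** A strict finite bound excludes [+oo], so the distance is the length of an actual walk. *)
Lemma dist_lt_walk (G : sgraph) (d : nat) (x y : G) :
  (dist x y < d%:Z%:E)%E -> exists2 e, (e < d)%N & walk e x y.
Proof.
rewrite /dist; case: {-}_ / idP => [cxy|//]; case: ex_minnP => m w _.
by rewrite lte_fin ltz_nat => md; exists m.
Qed.

(** If all distances are below [d], so is their maximum; positivity of [d] covers the value 0 from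
    which the maxima start. *)
Lemma diameter_ge (G : sgraph) (d : nat) :
  (0 < d)%N -> (d%:Z%:E <= diameter G)%E ->
  exists x y : G, (d%:Z%:E <= dist x y)%E.
Proof.
move=> d0 dG; apply/'exists_existsP/contraT=> /existsPn far.
suff: (diameter G < d%:Z%:E)%E by rewrite ltNge dG.
have d0' : (0 < d%:Z%:E :> \bar int)%E by rewrite lte_fin ltz_nat.
rewrite /diameter; apply: (big_ind (fun a => (a < d%:Z%:E)%E)) => //.
  by move=> a b; rewrite gt_max => -> ->.
move=> x _; apply: (big_ind (fun a => (a < d%:Z%:E)%E)) => //.
  by move=> a b; rewrite gt_max => -> ->.
by move=> y _; rewrite ltNge; have /existsPn/(_ y) := far x.
Qed.

Lemma far_set_diameter5 (G : sgraph) :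
  (5%:Z%:E <= diameter G)%E -> far_set G = [set: G].
Proof.
case/diameter_ge=> // x [y xy]; apply/setP=> v; rewrite !inE.
apply/contraT=> /existsPn near.
have [e e3 xv] : exists2 e, (e < 3)%N & walk e x v.
  by apply: dist_lt_walk; rewrite ltNge near.
have [f f3 yv] : exists2 f, (f < 3)%N & walk f y v.
  by apply: dist_lt_walk; rewrite ltNge near.
(* Joined at [v], the two walks lead from [x] to [y] in [e + f], hence at most 4, steps. *)
have := le_trans xy (dist_le_walk (walk_cat xv (walk_sym yv))).
by rewrite lee_fin lez_nat; lia.
Qed.

Lemma degreeE (R : rcfType) (G : sgraph) (i : 'I_#|G|) :
  (degree (enum_val i))%:R = \sum_j adjacency_mx R G i j :> R.
Proof.
rewrite /degree -sum1_card natr_sum big_mkcond /=.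
rewrite (reindex_onto (@enum_val G G) enum_rank) /=; last first.
  by move=> v _; rewrite enum_rankK.
apply: eq_big => [j|j _]; first by rewrite enum_valK eqxx.
by rewrite inE mxE; case: adj.
Qed.

(** The double sum runs over ordered pairs and meets each edge twice, whence the factor 2. *)
Lemma laplacian_quadratic_form (R : rcfType) (G : sgraph) (u : 'rV[R]_#|G|) :
  2 * (u *m laplacian R G *m u^T) 0 0 =
  \sum_i \sum_j adjacency_mx R G i j * (u 0 i - u 0 j) ^+ 2.
Proof.
set A := adjacency_mx R G.
have Asym i j : A i j = A j i by rewrite !mxE adj_sym.
have -> : (u *m laplacian R G *m u^T) 0 0 =
    \sum_i \sum_j A i j * (u 0 i * (u 0 i - u 0 j)).
  rewrite mxE; apply: eq_bigr => i _.
  rewrite /laplacian mulmxBr mul_mx_diag !mxE degreeE -/A.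
  rewrite mulrBl [X in X * _]mulr_sumr mulr_suml mulr_suml -sumrB.
  by apply: eq_bigr => j _; rewrite (Asym j i); ring.
(* One of the two copies has [i] and [j] swapped: a(a - b) + b(b - a) = (a - b)^2. *)
rewrite mulr_natl mulr2n {2}exchange_big -big_split /=.
apply: eq_bigr => i _; rewrite -big_split /=.
by apply: eq_bigr => j _; rewrite (Asym j i); ring.
Qed.

(** For a left eigenvector [u], the form at [u] equals [a] times the positive number [u *m u^T], and
    it is a sum of squares with weights 0 or 1, up to the factor 2. *)
Lemma laplacian_eigenvalue_ge0 (R : rcfType) (G : sgraph) (a : R) :
  eigenvalue (laplacian R G) a -> 0 <= a.
Proof.
case/eigenvalueP=> u uL u0.
have uu : 0 < (u *m u^T) 0 0.
  rewrite mxE; have [i ui] : exists i, u 0 i != 0.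
    by apply/rV0Pn.
  rewrite (bigD1 i) //= ltr_pwDl //.
    by rewrite mxE -expr2 exprn_even_gt0.
  by apply: sumr_ge0 => j _; rewrite mxE -expr2 sqr_ge0.
rewrite -(pmulr_lge0 _ uu) -(pmulr_rge0 _ (ltr0n R 2)).
have := laplacian_quadratic_form u.
rewrite uL -scalemxAl mxE => ->.
do 2!apply: sumr_ge0 => ? _.
by rewrite mulr_ge0 ?sqr_ge0 // mxE.
Qed.

Lemma lambda_ge0 (R : rcfType) (G : sgraph) (i : nat) : 0 <= lambda R G i.
Proof.
rewrite /lambda; set s := eigenvalues _.
(* Beyond the end of the list, [lambda] takes the default value 0. *)
have [si|si] := ltnP i.-1 (size s); last by rewrite nth_default.
apply: (@laplacian_eigenvalue_ge0 _ G).
by rewrite eigenvalue_root_char laplacian_eigenvaluesP root_prod_XsubC mem_nth.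
Qed.

Theorem proposition3p2 (R : rcfType) (G : sgraph) :
  (2 <= #|G|)%N ->
  (5%:Z%:E <= diameter G)%E ->
  let n : R := #|G|%:R in
  let k : R := #|far_set G|%:R / 2 in
  lambda R G 2 >=
    (n - k + 1 - Num.sqrt ((n - k + 1) ^+ 2 - 4 * (n - 2 * k))) / 2.
Proof.
move=> _ diam5; rewrite far_set_diameter5 // cardsT /=.
set n : R := #|G|%:R; set k := n / 2.
have nk : n = 2 * k by rewrite mulrC divfK ?pnatr_eq0.
have k0 : 0 <= k by rewrite divr_ge0 ?ler0n.
(* As n = 2k, the radicand is the square of n - k + 1 = k + 1, which is nonnegative, so the root
   cancels the leading terms. *)
rewrite -nk subrr mulr0 subr0 sqrtr_sqr ger0_norm; last by lra.
by rewrite subrr mul0r lambda_ge0.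
Qed.
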